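(* Let $p$ be a prime number, and let $\tau,\sigma,f\colon\mathbb{Q}_p\to\mathbb{Q}_p$ be Schneider's continued fraction map, the shift map, and the map $f$ defined in the context. Then $f\circ\tau=\sigma\circ f$.
   Context: $p$ is a fixed prime; $\mathbb{N}$ includes $0$; $v\colon\mathbb{Q}_p\to\mathbb{Z}\cup\{\infty\}$ is the $p$-adic valuation and $|x|_p=p^{-v(x)}$ for $x\neq 0$, $|0|_p=0$. Define $\epsilon(x):=|x|_p\,x\in\mathbb{Z}_p^\times$ for $x\in\mathbb{Q}_p^\times$ (here $|x|_p$ is viewed as the rational number $p^{-v(x)}$), and $\epsilon(0):=1$. Thus $x/\epsilon(x)=p^{v(x)}$ for $x\neq0$, and $0/\epsilon(0)=0$. For $x\in\mathbb{Z}_p$, $\lfloor x\rfloor_p$ is the unique element of $\{0,\ldots,p-1\}$ with $|x-\lfloor x\rfloor_p|_p<1$. Schneider's continued fraction map is $\tau\colon\mathbb{Q}_p\to\mathbb{Q}_p$, $\tau(x):=\frac{1}{\epsilon(x)}-\left\lfloor\frac{1}{\epsilon(x)}\right\rfloor_p$. The shift map is $\sigma\colon\mathbb{Q}_p\to\mathbb{Q}_p$, $\sigma(x):=\epsilon(x)-\lfloor\epsilon(x)\rfloor_p$. The map $f\colon\mathbb{Q}_p\to\mathbb{Q}_p$ is defined by the series, convergent in $\mathbb{Q}_p$, $f(x):=\sum_{n=0}^{\infty}\left\lfloor \frac{1}{\epsilon(\tau^n(x))}\right\rfloor_p\prod_{m=0}^n\frac{\tau^m(x)}{\epsilon(\tau^m(x))}$,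 where $\tau^n$ is the $n$-fold iterate and $\tau^0$ is the identity. *)

(* Defs.v *)
From HB Require Import structures.
From mathcomp Require Import all_boot all_order all_algebra ring zify.
From mathcomp Require Import all_classical all_reals all_analysis.

Set Implicit Arguments.
Unset Strict Implicit.
Unset Printing Implicit Defensive.

Import Order.TTheory GRing.Theory Num.Theory.

Local Open Scope ring_scope.
Local Open Scope classical_set_scope.

(* The ring Z_p is the inverse limit of the rings Z/p^n: an element is the
   family of its residues [res n] in {0, ..., p^n - 1}.  The single equation
   [res_compat] says both that [res n] is reduced modulo p^n and that it is the
   image of [res n.+1].  The primality proof is a parameter of the type only so
   that the integral domain structure can be attached to it. *)
Record padic_int (p : nat) (pr_p : prime p) := PadicInt {
  res :> nat -> int;
  res_compat : forall n, (res n.+1 %% (p ^ n)%N%:Z)%Z = res n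
}.

HB.instance Definition _ p (pr_p : prime p) := gen_eqMixin (padic_int pr_p).
HB.instance Definition _ p (pr_p : prime p) := gen_choiceMixin (padic_int pr_p).

Section PadicIntRing.
Variables (p : nat) (pr_p : prime p).
Local Notation Zp := (padic_int pr_p).
Local Notation q n := ((p ^ n)%N%:Z).
Implicit Types x y z : Zp.

Lemma modz_dvdm (a d e : int) : (d %| e)%Z -> ((a %% e)%Z %% d)%Z = (a %% d)%Z.
Proof. by move=> /dvdzP[k ->]; rewrite [in RHS](divz_eq a (k * d)) mulrA modzMDl. Qed.

Lemma dvdz_q m n : (m <= n)%N -> (q m %| q n)%Z.
Proof. by move=> mn; rewrite dvdzE /=; exact: dvdn_exp2l. Qed.

Lemma modz_modS (a : int) n : ((a %% q n.+1)%Z %% q n)%Z = (a %% q n)%Z.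
Proof. by rewrite modz_dvdm // dvdz_q. Qed.

Lemma res_mod x n : (x n %% q n)%Z = x n.
Proof. by rewrite -res_compat modz_mod. Qed.

Lemma padic_int_eq x y : (forall n, (x n = y n %[mod q n])%Z) -> x = y.
Proof.
move=> xy; have {xy} : x = y :> (nat -> int).
  by apply: funext => n; rewrite -res_mod xy res_mod.
case: x y => [x hx] [y hy] /= xy; subst y.
by congr PadicInt; exact: Prop_irrelevance.
Qed.

Fact mk_compat (u : nat -> int) :
    (forall n, (u n.+1 = u n %[mod q n])%Z) ->
  forall n, ((u n.+1 %% q n.+1)%Z %% q n)%Z = (u n %% q n)%Z.
Proof. by move=> hu n; rewrite modz_modS hu. Qed.

Definition mk_padic_int (u : nat -> int)
  (hu : forall n, (u n.+1 = u n %[mod q n])%Z) : Zp := PadicInt pr_p (mk_compat hu).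

Fact add_compat x y n : (x n.+1 + y n.+1 = x n + y n %[mod q n])%Z.
Proof. by rewrite -modzDm !res_compat. Qed.

Fact opp_compat x n : (- x n.+1 = - x n %[mod q n])%Z.
Proof. by rewrite -modzNm res_compat. Qed.

Fact mul_compat x y n : (x n.+1 * y n.+1 = x n * y n %[mod q n])%Z.
Proof. by rewrite -modzMm !res_compat. Qed.

Definition padic_int_const (a : int) : Zp :=
  @mk_padic_int (fun=> a) (fun=> erefl).
Definition padic_int_add x y : Zp := mk_padic_int (add_compat x y).
Definition padic_int_opp x : Zp := mk_padic_int (opp_compat x).
Definition padic_int_mul x y : Zp := mk_padic_int (mul_compat x y).

Fact padic_int_addA : associative padic_int_add.
Proof. by move=> x y z; apply: padic_int_eq => n /=; rewrite !modz_mod modzDmr modzDml addrA. Qed.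

Fact padic_int_addC : commutative padic_int_add.
Proof. by move=> x y; apply: padic_int_eq => n /=; rewrite addrC. Qed.

Fact padic_int_add0 : left_id (padic_int_const 0) padic_int_add.
Proof. by move=> x; apply: padic_int_eq => n /=; rewrite modz_mod modzDml add0r. Qed.

Fact padic_int_addN : left_inverse (padic_int_const 0) padic_int_opp padic_int_add.
Proof. by move=> x; apply: padic_int_eq => n /=; rewrite !modz_mod modzDml addNr. Qed.

HB.instance Definition _ := GRing.isZmodule.Build Zp
  padic_int_addA padic_int_addC padic_int_add0 padic_int_addN.

Fact padic_int_mulA : associative padic_int_mul.
Proof. by move=> x y z; apply: padic_int_eq => n /=; rewrite !modz_mod modzMmr modzMml mulrA. Qed.

Fact padic_int_mulC : commutative padic_int_mul.
Proof. by move=> x y; apply: padic_int_eq => n /=; rewrite mulrC. Qed.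

Fact padic_int_mul1 : left_id (padic_int_const 1) padic_int_mul.
Proof. by move=> x; apply: padic_int_eq => n /=; rewrite modz_mod modzMml mul1r. Qed.

Fact padic_int_mulDl : left_distributive padic_int_mul +%R.
Proof.
move=> x y z; apply: padic_int_eq => n /=.
by rewrite !modz_mod modzMml modzDm mulrDl.
Qed.

Fact padic_int_oner_neq0 : padic_int_const 1 != 0 :> Zp.
Proof.
apply/eqP => /(congr1 (fun x : Zp => x 1%N)) /=.
rewrite expn1 mod0z => /dvdz_mod0P; rewrite dvdzE /= dvdn1.
by case: eqP pr_p => // ->.
Qed.

HB.instance Definition _ := GRing.Zmodule_isComNzRing.Build Zp
  padic_int_mulA padic_int_mulC padic_int_mul1 padic_int_mulDl
  padic_int_oner_neq0.

Lemma resD x y n : (x + y) n = ((x n + y n) %% q n)%Z. Proof. by []. Qed.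
Lemma resM x y n : (x * y) n = ((x n * y n) %% q n)%Z. Proof. by []. Qed.
Lemma res0 n : (0 : Zp) n = 0. Proof. exact: mod0z. Qed.

Lemma res_le x m n : (m <= n)%N -> (x n %% q m)%Z = x m.
Proof.
move=> /subnK <-; elim: (n - m)%N => [|k IH]; first by rewrite add0n res_mod.
by rewrite -IH addSn -[in RHS]res_compat modz_dvdm // dvdz_q // leq_addl.
Qed.

Lemma res_eq0 x m n : (m <= n)%N -> (x m == 0) = (q m %| x n)%Z.
Proof. by move=> mn; rewrite -(res_le x mn); apply/eqP/dvdz_mod0P. Qed.

Lemma padic_int_eq0 x : (forall n, x n = 0) -> x = 0.
Proof. by move=> x0; apply: padic_int_eq => n; rewrite x0 res0. Qed.

Lemma padic_int_neq0 x : x != 0 -> exists n, x n.+1 != 0.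
Proof.
move=> x0; apply: contrapT => /forallNP h; case/eqP: x0.
apply: padic_int_eq0 => n; rewrite -res_compat.
by have /negP := h n; rewrite negbK => /eqP ->; rewrite mod0z.
Qed.

Definition padic_int_unit x : bool := `[< exists y, y * x = 1 >].
Definition padic_int_inv x : Zp :=
  if pselect (exists y, y * x = 1) is left h then projT1 (cid h) else x.

Fact padic_int_mulV : {in padic_int_unit, left_inverse 1 padic_int_inv *%R}.
Proof.
move=> x /asboolP h; rewrite /padic_int_inv.
by case: pselect => // h'; case: cid.
Qed.

Fact padic_int_unitP x y : y * x = 1 -> padic_int_unit x.
Proof. by move=> h; apply/asboolP; exists y. Qed.

Fact padic_int_inv_out : {in [predC padic_int_unit], padic_int_inv =1 id}.
Proof.
move=> x /negP h; rewrite /padic_int_inv.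
by case: pselect => // h'; case: h; apply/asboolP.
Qed.

HB.instance Definition _ := GRing.ComNzRing_hasMulInverse.Build Zp
  padic_int_mulV padic_int_unitP padic_int_inv_out.

(* For x != 0 this is the largest n such that the residue of x modulo p^n
   vanishes (see [padic_int_valP]), that is, such that p^n divides x; the value
   at 0 is irrelevant. *)
Definition padic_int_val x : nat :=
  if pselect (exists n, x n.+1 != 0) is left h then ex_minn h else 0%N.

Lemma padic_int_valP x n : x != 0 -> (x n == 0) = (n <= padic_int_val x)%N.
Proof.
move=> /padic_int_neq0 hx; rewrite /padic_int_val; case: pselect => // h.
case: ex_minnP => m xm mmin; apply/idP/idP.
  move=> /eqP xn; rewrite leqNgt; apply/negP => mn.
  by move: xm; rewrite -(res_le x mn) xn mod0z eqxx.
case: n => [_|n nm]; first by rewrite -res_mod modz1.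
by apply: contraTT nm => /mmin; rewrite -leqNgt.
Qed.

Lemma dvdz_logn (a : int) n : a != 0 ->
  (q n %| a)%Z = (n <= logn p `|a|)%N.
Proof. by move=> a0; rewrite dvdzE /= pfactor_dvdn // absz_gt0. Qed.

Lemma padic_int_val_logn x n : x != 0 -> (padic_int_val x < n)%N ->
  (x n != 0) /\ logn p `|x n| = padic_int_val x.
Proof.
move=> x0 vn; have xn : x n != 0 by rewrite padic_int_valP // -ltnNge.
split=> //; apply/eqP; rewrite eqn_leq; apply/andP; split.
  rewrite leqNgt -(dvdz_logn _ xn) -res_eq0 //.
  by rewrite padic_int_valP // ltnn.
by rewrite -(dvdz_logn _ xn) -res_eq0 ?(ltnW vn) // padic_int_valP.
Qed.

Lemma padic_int_val_mul x y : x != 0 -> y != 0 ->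
  x * y != 0 /\ padic_int_val (x * y)%R = (padic_int_val x + padic_int_val y)%N.
Proof.
move=> x0 y0; set v := (_ + _)%N.
have xyE n : ((x * y) n == 0) = (n <= v)%N.
  have /(padic_int_val_logn x0)[xN xNv] : (padic_int_val x < (n + v).+1)%N.
    by rewrite ltnS /v addnCA leq_addr.
  have /(padic_int_val_logn y0)[yN yNv] : (padic_int_val y < (n + v).+1)%N.
    by rewrite ltnS /v addnA leq_addl.
  rewrite (@res_eq0 _ n (n + v).+1); last by rewrite ltnW // ltnS leq_addr.
  rewrite resM (_ : (q n %| _)%Z = (q n %| x (n + v).+1 * y (n + v).+1)%Z).
    by rewrite dvdz_logn ?mulf_neq0 // abszM lognM ?absz_gt0 // xNv yNv.
  have qn : (q n %| q (n + v).+1)%Z by rewrite dvdz_q // ltnW // ltnS leq_addr.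
  by apply/dvdz_mod0P/dvdz_mod0P; rewrite modz_dvdm.
have xy0 : x * y != 0.
  by apply/eqP => xy0; have := xyE v.+1; rewrite xy0 res0 eqxx ltnn.
split=> //; apply/eqP; rewrite eqn_leq -xyE padic_int_valP // leqnn.
by rewrite -padic_int_valP // xyE leqnn.
Qed.

Fact padic_int_mulf_eq0 x y : x * y = 0 -> (x == 0) || (y == 0).
Proof.
move=> xy0; apply/norP => -[x0 y0].
by have [/eqP] := padic_int_val_mul x0 y0.
Qed.

HB.instance Definition _ :=
  GRing.ComUnitRing_isIntegral.Build Zp padic_int_mulf_eq0.

Lemma padic_int_valM x y : x != 0 -> y != 0 ->
  padic_int_val (x * y)%R = (padic_int_val x + padic_int_val y)%N.
Proof. by move=> x0 y0; have [] := padic_int_val_mul x0 y0. Qed.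

Lemma padic_int_valD x y : x != 0 -> y != 0 -> x + y != 0 ->
  (minn (padic_int_val x) (padic_int_val y) <= padic_int_val (x + y)%R)%N.
Proof.
move=> x0 y0 xy0; rewrite -padic_int_valP // resD.
have /eqP -> : x (minn (padic_int_val x) (padic_int_val y)) == 0.
  by rewrite padic_int_valP // geq_minl.
have /eqP -> : y (minn (padic_int_val x) (padic_int_val y)) == 0.
  by rewrite padic_int_valP // geq_minr.
by rewrite addr0 mod0z.
Qed.

End PadicIntRing.

Definition padic (p : nat) (pr_p : prime p) : Type := {fraction padic_int pr_p}.

HB.instance Definition _ p (pr_p : prime p) := GRing.Field.on (padic pr_p).

Section PadicField.
Variables (p : nat) (pr_p : prime p).
Local Notation Zp := (padic_int pr_p).
Local Notation Qp := (padic pr_p).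
Implicit Types x y z : Qp.

(* Only meaningful for x != 0: v(0) = oo is not represented, and [padic_abs]
   treats 0 separately. *)
Definition padic_val x : int :=
  (padic_int_val ((frac (repr x)).1))%:Z - (padic_int_val ((frac (repr x)).2))%:Z.

Definition padic_abs x : rat := if x == 0 then 0 else p%:R ^ (- padic_val x).

Local Notation "a %:F" := (@FracField.tofrac (padic_int pr_p) a : Qp).

Lemma padic_fracE x : x = ((frac (repr x)).1)%:F / ((frac (repr x)).2)%:F.
Proof.
set a := (frac (repr x)).1; set b := (frac (repr x)).2.
have b0 : b != 0 by exact: denom_ratioP.
have bF0 : b%:F != 0 by rewrite tofrac_eq0.
apply: (mulIf bF0); rewrite mulfVK //.
rewrite -[x in LHS](@reprK _ {fraction Zp}) -(Ratio_numden (repr x)) -/a -/b.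
unlock FracField.tofrac; rewrite -[LHS]FracField.pi_mul.
apply/eqmodP => /=; rewrite FracField.equivfE /FracField.mulf.
by rewrite !numden_Ratio ?mulf_neq0 ?oner_neq0 //; apply/eqP; ring.
Qed.

Lemma padic_val_frac (a b : Zp) : a != 0 -> b != 0 ->
  padic_val (a%:F / b%:F) = (padic_int_val a)%:Z - (padic_int_val b)%:Z.
Proof.
move=> a0 b0; rewrite /padic_val; set x := _ / _.
have := padic_fracE x; set c := (frac (repr x)).1; set d := (frac (repr x)).2 => xE.
have d0 : d != 0 by exact: denom_ratioP.
have aF0 : a%:F != 0 by rewrite tofrac_eq0.
have bF0 : b%:F != 0 by rewrite tofrac_eq0.
have dF0 : d%:F != 0 by rewrite tofrac_eq0.
have adcb : a * d = c * b.
  apply/eqP; rewrite -(@tofrac_eq Zp) !tofracM; apply/eqP.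
  have -> : a%:F = x * b%:F by rewrite /x mulfVK.
  by rewrite xE mulrAC mulfVK.
have c0 : c != 0.
  by apply/eqP => c0; move/eqP: adcb; rewrite c0 mul0r mulf_eq0 (negbTE a0) (negbTE d0).
have := congr1 (@padic_int_val p pr_p) adcb; rewrite !padic_int_valM // => h.
by apply/eqP; rewrite subr_eq addrAC eq_sym subr_eq -!PoszD h.
Qed.

Lemma padic_num0 x : x != 0 -> (frac (repr x)).1 != 0.
Proof.
apply: contra => /eqP n0; apply/eqP; rewrite (padic_fracE x) n0.
by rewrite tofrac0 mul0r.
Qed.

Lemma padic_valM x y : x != 0 -> y != 0 ->
  padic_val (x * y) = padic_val x + padic_val y.
Proof.
move=> /padic_num0 x0 /padic_num0 y0.
rewrite {1}(padic_fracE x) {1}(padic_fracE y) mulf_div -!tofracM.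
rewrite padic_val_frac ?mulf_neq0 ?denom_ratioP //.
by rewrite /padic_val !padic_int_valM ?denom_ratioP // !PoszD; ring.
Qed.

Lemma padic_valD x y : x != 0 -> y != 0 -> x + y != 0 ->
  Num.min (padic_val x) (padic_val y) <= padic_val (x + y).
Proof.
move=> /padic_num0 x0 /padic_num0 y0.
rewrite {1 3}(padic_fracE x) {1 3}(padic_fracE y).
have xd0 := denom_ratioP (repr x); have yd0 := denom_ratioP (repr y).
rewrite addf_div ?tofrac_eq0 ?denom_ratioP // -!tofracM -tofracD => xy0.
have {}xy0 : (frac (repr x)).1 * (frac (repr y)).2 + (frac (repr y)).1 * (frac (repr x)).2 != 0.
  by apply: contra xy0 => /eqP ->; rewrite tofrac0 mul0r.
rewrite padic_val_frac ?mulf_neq0 //.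
have := padic_int_valD _ _ xy0; rewrite !mulf_neq0 // => /(_ isT isT).
rewrite ge_min geq_min /padic_val !padic_int_valM //.
move: (padic_int_val (frac (repr x)).1) (padic_int_val (frac (repr x)).2)
  (padic_int_val (frac (repr y)).1) (padic_int_val (frac (repr y)).2)
  (padic_int_val (_ + _)) => vx1 vx2 vy1 vy2 v.
by clear=> /orP[h|h]; apply/orP; [left|right]; lia.
Qed.

Lemma padic_absE x : x != 0 -> padic_abs x = p%:R ^ (- padic_val x).
Proof. by move=> /negbTE x0; rewrite /padic_abs x0. Qed.

Let p_gt1 : 1 < p%:R :> rat. Proof. by rewrite ltr1n prime_gt1. Qed.

Let p_neq0 : p%:R != 0 :> rat.
Proof. by rewrite pnatr_eq0 -lt0n prime_gt0. Qed.

Lemma padic_abs0 : padic_abs 0 = 0. Proof. by rewrite /padic_abs eqxx. Qed.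

Lemma padic_abs_ge0 x : 0 <= padic_abs x.
Proof. by rewrite /padic_abs; case: eqP => // _; rewrite exprz_ge0 // ler0n. Qed.

Lemma padic_abs_eq0 x : padic_abs x = 0 -> x = 0.
Proof.
rewrite /padic_abs; case: eqP => // _ /eqP; rewrite expfz_eq0.
by rewrite (negbTE p_neq0) andbF.
Qed.

Lemma padic_absM x y : padic_abs (x * y) = padic_abs x * padic_abs y.
Proof.
have [->|x0] := eqVneq x 0; first by rewrite mul0r padic_abs0 mul0r.
have [->|y0] := eqVneq y 0; first by rewrite mulr0 padic_abs0 mulr0.
by rewrite !padic_absE ?mulf_neq0 // padic_valM // opprD expfzDr.
Qed.

Lemma padic_abs1 : padic_abs 1 = 1.
Proof.
have h : padic_abs 1 != 0 by apply/eqP => /padic_abs_eq0/eqP; rewrite oner_eq0.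
by apply: (mulIf h); rewrite -padic_absM !mul1r.
Qed.

Lemma padic_absN x : padic_abs (- x) = padic_abs x.
Proof.
rewrite -mulN1r padic_absM; suff -> : padic_abs (-1) = 1 by rewrite mul1r.
apply/eqP; rewrite -(@eqrXn2 _ 2) ?padic_abs_ge0 //.
by rewrite expr2 -padic_absM mulrNN !mul1r padic_abs1 expr1n.
Qed.

Lemma padic_abs_ultra x y :
  padic_abs (x + y) <= Num.max (padic_abs x) (padic_abs y).
Proof.
have [->|x0] := eqVneq x 0; first by rewrite add0r le_max lexx orbT.
have [->|y0] := eqVneq y 0; first by rewrite addr0 le_max lexx.
have [->|xy0] := eqVneq (x + y) 0.
  by rewrite padic_abs0 le_max padic_abs_ge0.
rewrite !padic_absE // le_max !ler_eXz2l // !lerN2 -ge_min.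
exact: padic_valD.
Qed.

Lemma padic_abs_p : padic_abs p%:R = p%:R^-1.
Proof.
have resn (k n : nat) : (k%:R : Zp) n = (k%:Z %% (p ^ n)%N%:Z)%Z.
  elim: k => [|k IH]; first by rewrite res0 mod0z.
  by rewrite -natr1 resD IH /= modzDm -PoszD addn1.
have pE : (p%:R : Qp) = (p%:R : Zp)%:F / 1%:F.
  by rewrite tofrac1 divr1 -[RHS]/(@FracField.tofrac Zp p%:R) rmorph_nat.
have res2 : (p%:R : Zp) 2%N != 0.
  rewrite resn modz_nat modn_small; first by rewrite -lt0n prime_gt0.
  by rewrite -{1}(expn1 p) ltn_exp2l ?prime_gt1.
have pZ0 : (p%:R : Zp) != 0 by apply: contra res2 => /eqP ->; rewrite res0.
have vp : padic_int_val (p%:R : Zp) = 1%N.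
  apply/eqP; rewrite eqn_leq -padic_int_valP // resn expn1 modzz andbT.
  by rewrite leqNgt -padic_int_valP.
have v1 : padic_int_val (1 : Zp) = 0%N.
  have := padic_int_valM (oner_neq0 Zp) (oner_neq0 Zp).
  by rewrite mul1r => /eqP; rewrite -{1}[padic_int_val 1]addn0 eqn_add2l => /eqP.
rewrite padic_absE; last by rewrite pE tofrac1 divr1 tofrac_eq0.
by rewrite pE padic_val_frac ?oner_neq0 // vp v1 subr0 exprN1.
Qed.

Definition padic_dist x y : rat := padic_abs (x - y).

Fact padic_distxx x : padic_dist x x = 0.
Proof. by rewrite /padic_dist subrr padic_abs0. Qed.

Fact padic_dist_eq0 x y : padic_dist x y = 0 -> x = y.
Proof. by move=> /padic_abs_eq0 /eqP; rewrite subr_eq0 => /eqP. Qed.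

Fact padic_distC x y : padic_dist x y = padic_dist y x.
Proof. by rewrite /padic_dist -padic_absN opprB. Qed.

Fact padic_dist_triangle y x z :
  padic_dist x z <= padic_dist x y + padic_dist y z.
Proof.
rewrite /padic_dist -(subrKA y x (- z)) (le_trans (padic_abs_ultra _ _)) //.
by rewrite ge_max lerDl lerDr !padic_abs_ge0.
Qed.

HB.instance Definition _ := isMetric.Build rat Qp
  padic_distxx padic_dist_eq0 padic_distC padic_dist_triangle.

HB.instance Definition _ := isPointed.Build Qp 0.

(* The map epsilon: the rational number |x|_p is viewed in Q_p through [ratr]. *)
Definition unit_part x : Qp := if x == 0 then 1 else ratr (padic_abs x) * x.

(* Exactly one digit passes the test when x lies in Z_p; outside Z_p none does
   and 0 is returned, a case that never arises in the maps below. *)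
Definition padic_floor x : nat :=
  if [pick i : 'I_p | padic_abs (x - (i : nat)%:R) < 1] is Some i then i else 0%N.

Definition schneider x : Qp :=
  (unit_part x)^-1 - (padic_floor (unit_part x)^-1)%:R.

Definition padic_shift x : Qp := unit_part x - (padic_floor (unit_part x))%:R.

Definition conj_term x (n : nat) : Qp :=
  (padic_floor (unit_part (iter n schneider x))^-1)%:R *
  \prod_(0 <= m < n.+1) (iter m schneider x / unit_part (iter m schneider x)).

(* This series converges for every x, so the default value of [lim] is never
   used. *)
Definition conj_map x : Qp := limn (series (conj_term x)).

End PadicField.

Arguments schneider {p} pr_p x.
Arguments padic_shift {p} pr_p x.
Arguments conj_map {p} pr_p x.

(* Main.v *)
(** Write [tau], [sigma], [f] for the three maps, [eps] for the unit part and
    [d x] for the digit of [1 / eps x].  Splitting off the first term of the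
    series gives, for [x != 0],
      [f x = p ^ v(x) * (d x + f (tau x))].
    Since [|tau x| < 1], every term of the series of [f (tau x)] is a natural
    number, the n-th one divisible by [p ^ (n + 1)]; hence it converges and
    [|f (tau x)| < 1].  As [d x] is a unit, [d x + f (tau x)] is the unit part of
    [f x] and [d x] is its digit, so [sigma] maps [f x] to [f (tau x)].  For
    [x = 0] both sides vanish. *)

Require Import Defs.
From mathcomp Require Import all_boot all_order all_algebra zify.
From mathcomp Require Import all_classical all_analysis.

Set Implicit Arguments.
Unset Strict Implicit.
Unset Printing Implicit Defensive.

Import Order.TTheory GRing.Theory Num.Theory.

Local Open Scope ring_scope.
Local Open Scope classical_set_scope.

Section Padic.
Variables (p : nat) (pr_p : prime p).
Local Notation Zp := (padic_int pr_p).
Local Notation Qp := (padic pr_p).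
Local Notation "a %:F" := (@FracField.tofrac (padic_int pr_p) a : Qp).
Implicit Types (x y z : Qp) (a b : Zp).

Let p_gt1 : 1 < p%:R :> rat. Proof. by rewrite ltr1n prime_gt1. Qed.

Let p_gt0 : 0 < p%:R :> rat. Proof. by rewrite ltr0n prime_gt0. Qed.

(** * Residues and the absolute value *)

Lemma tofrac_nat (n : nat) : (n%:R : Zp)%:F = n%:R.
Proof. by rewrite -[LHS]/(@FracField.tofrac Zp n%:R) rmorph_nat. Qed.

Lemma res_nat (k n : nat) : (k%:R : Zp) n = (k%:Z %% (p ^ n)%N%:Z)%Z.
Proof.
elim: k => [|k IH]; first by rewrite res0 mod0z.
by rewrite -natr1 resD IH /= modzDm -PoszD addn1.
Qed.

Lemma resB a b n : (a - b) n = ((a n - b n) %% (p ^ n)%N%:Z)%Z.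
Proof. by rewrite resD /= modzDmr. Qed.

Lemma padic_int_val1 : padic_int_val (1 : Zp) = 0%N.
Proof.
have := padic_int_valM (oner_neq0 Zp) (oner_neq0 Zp).
by rewrite mul1r => /eqP; rewrite -{1}[padic_int_val 1]addn0 eqn_add2l => /eqP.
Qed.

(** Dictionary between estimates and congruences: bounds on p-adic integers are checked below on
    residues modulo [p ^ n]. *)
Lemma padic_abs_tofrac_le a n : (padic_abs (a%:F) <= p%:R ^- n) = (a n == 0).
Proof.
have [->|a0] := eqVneq a 0.
  by rewrite tofrac0 padic_abs0 res0 eqxx invr_ge0 exprn_ge0 // ler0n.
have aF0 : a%:F != 0 by rewrite tofrac_eq0.
have va : padic_val (a%:F) = padic_int_val a.
  by rewrite -[a%:F]divr1 -tofrac1 padic_val_frac ?oner_neq0 // padic_int_val1 subr0.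
by rewrite padic_absE // exprnN ler_eXz2l // lerN2 va padic_int_valP.
Qed.

(** Nonzero absolute values are integral powers of [p], so none lies strictly between [p^-1] and
    1. *)
Lemma padic_abs_lt1 x : (padic_abs x < 1) = (padic_abs x <= p%:R^-1).
Proof.
have [->|x0] := eqVneq x 0; first by rewrite padic_abs0 ltr01 invr_ge0 ltW.
by rewrite padic_absE // -(expr0z p%:R) -exprN1 ltr_eXz2l // ler_eXz2l // -ltzD1 addNr.
Qed.

Lemma padic_abs_nat_lt1 (n : nat) : (padic_abs (n%:R : Qp) < 1) = (p %| n)%N.
Proof.
rewrite padic_abs_lt1 -tofrac_nat -[X in _ <= X^-1]expr1 padic_abs_tofrac_le res_nat.
by rewrite expn1 modz_nat.
Qed.

Lemma padic_absB_lt x y (e : rat) :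
  padic_abs x < e -> padic_abs y < e -> padic_abs (x - y) < e.
Proof.
move=> xe ye; apply: le_lt_trans (padic_abs_ultra _ _) _.
by rewrite padic_absN gt_max xe.
Qed.

(** Isosceles triangle principle: if [|x|] were smaller too, [y = x - (x - y)] would have absolute
    value below [|y|]. *)
Lemma padic_abs_eq x y : padic_abs (x - y) < padic_abs y -> padic_abs x = padic_abs y.
Proof.
move=> xy; apply/eqP; rewrite eq_le; apply/andP; split.
  rewrite -{1}(subrK y x) (le_trans (padic_abs_ultra _ _)) //.
  by rewrite ge_max lexx ltW.
rewrite leNgt; apply/negP => xlt; have := padic_absB_lt xlt xy.
by rewrite opprB addrC subrK ltxx.
Qed.

(** * Existence and uniqueness of the digit *)

Lemma padic_digit_inj x (i j : nat) : (i < p)%N -> (j < p)%N ->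
  padic_abs (x - i%:R) < 1 -> padic_abs (x - j%:R) < 1 -> i = j.
Proof.
wlog ij : i j / (i <= j)%N => [th|] ip jp xi xj.
  by have [/th->|/ltnW/th->] := leqP i j.
(* This makes [j - i] a multiple of [p], while it is less than [p]. *)
have : padic_abs ((j - i)%N%:R : Qp) < 1.
  have -> : (j - i)%N%:R = x - i%:R - (x - j%:R).
    by rewrite natrB // opprB [RHS]addrC addrA subrK.
  exact: padic_absB_lt.
rewrite padic_abs_nat_lt1 => pij; apply/eqP; rewrite eqn_leq ij -subn_eq0.
have [//|/dvdn_leq/(_ pij)] := posnP (j - i).
by rewrite leqNgt (leq_ltn_trans (leq_subr _ _) jp).
Qed.

Lemma padic_floor_uniq x (i : nat) :
  (i < p)%N -> padic_abs (x - i%:R) < 1 -> padic_floor x = i.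
Proof.
move=> ip xi; rewrite /padic_floor; case: pickP => [j xj|/(_ (Ordinal ip))]; last first.
  by rewrite xi.
exact: padic_digit_inj xj xi.
Qed.

Lemma modp_div (a b : int) : ~~ (p %| b)%Z ->
  exists2 i : nat, (i < p)%N & (p %| a - i%:Z * b)%Z.
Proof.
move=> pb; have /coprimezP[[u v] /= uv] : coprimez b p.
  by rewrite coprimezE coprime_sym prime_coprime.
have p0 : p%:Z != 0 by case: p pr_p.
(* By Bezout, [u] inverts [b] modulo [p], so this is the quotient [a / b] modulo [p]. *)
exists `|(a * u) %% p|%Z%N.
  by rewrite -ltz_nat gez0_abs ?modz_ge0 // ltz_pmod // ltz_nat prime_gt0.
rewrite gez0_abs ?modz_ge0 //.
have -> : a - ((a * u) %% p)%Z * b = (a * v + ((a * u) %/ p)%Z * b) * p.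
  rewrite -[X in X - _](mulr1 a) -uv; move: (divz_eq (a * u) p).
  by set m := (_ %% _)%Z; set d := (_ %/ _)%Z; lia.
exact: dvdz_mull.
Qed.

(* For [x = a / b] with [b] of valuation [k], the digit is the solution [i] of
   [a = i * b] modulo [p ^ (k + 1)]. *)
Lemma padic_floorP x : padic_abs x <= 1 ->
  (padic_floor x < p)%N /\ padic_abs (x - (padic_floor x)%:R) < 1.
Proof.
move=> x1; suff [i ip xi] : exists2 i, (i < p)%N & padic_abs (x - i%:R) < 1.
  by rewrite (padic_floor_uniq ip xi).
have [->|x0] := eqVneq x 0.
  by exists 0%N; rewrite ?prime_gt0 // subrr padic_abs0.
move: x1; have := padic_fracE x.
set a := (frac (repr x)).1; set b := (frac (repr x)).2 => xE.
have b0 : b != 0 by exact: denom_ratioP.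
have a0 : a != 0 by exact: padic_num0.
rewrite padic_absE // -(expr0z p%:R) ler_eXz2l // oppr_le0 /padic_val -/a -/b.
rewrite subr_ge0 lez_nat => vba; set k := padic_int_val b in vba.
have [bk0 bkv] := padic_int_val_logn b0 (ltnSn k).
have /dvdzP[a' aE] : ((p ^ k)%N%:Z %| a k.+1)%Z.
  by rewrite -res_eq0 // padic_int_valP.
have /dvdzP[b' bE] : ((p ^ k)%N%:Z %| b k.+1)%Z.
  by rewrite -res_eq0 // padic_int_valP.
(* The valuation of [b] is exactly [k], so [b'] is invertible modulo [p] and the digit is [a' / b']
   modulo [p]. *)
have pb' : ~~ (p %| b')%Z.
  apply: contra bk0 => /dvdzP[c b'E].
  rewrite (@res_eq0 _ _ _ _ k.+1) // bE b'E -mulrA -PoszM -expnS.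
  exact: dvdz_mull.
have [i ip /dvdzP[c cE]] := modp_div a' pb'; exists i => //.
have bF0 : b%:F != 0 by rewrite tofrac_eq0.
have -> : x - i%:R = (a - i%:R * b)%:F / b%:F.
  by rewrite tofracB tofracM tofrac_nat mulrBl mulfK // -xE.
have babs : padic_abs (b%:F) = p%:R ^- k.
  rewrite padic_absE // -[b%:F]divr1 -tofrac1 padic_val_frac ?oner_neq0 //.
  by rewrite padic_int_val1 subr0 exprnN.
suff abs : padic_abs ((a - i%:R * b)%:F) <= p%:R ^- k.+1.
  have pk : 0 < p%:R ^- k :> rat by rewrite invr_gt0 exprn_gt0.
  rewrite -(ltr_pM2r pk) mul1r -babs -padic_absM divfK // babs.
  by rewrite (le_lt_trans abs) // ltf_pV2 ?posrE ?exprn_gt0 // ltr_eXn2l.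
rewrite padic_abs_tofrac_le.
have -> : (a - i%:R * b) k.+1 = ((a k.+1 - i%:Z * b k.+1) %% (p ^ k.+1)%N%:Z)%Z.
  by rewrite resB resM res_nat modzMml -modzDmr modzNm modzDmr.
apply/eqP/dvdz_mod0P; rewrite aE bE mulrA -mulrBl cE expnS PoszM -mulrA.
exact: dvdz_mull.
Qed.

(** * Powers of [p] and unit parts *)

Lemma ratr_expp (n : int) : ratr (p%:R ^ n) = p%:R ^ n :> Qp.
Proof.
case: n => n; first by rewrite -[_ ^ n]natrX ratr_nat natrX.
(* [ratr] divides the images of numerator and denominator; for a negative exponent these are
   computed to be 1 and [p ^ (n + 1)]. *)
rewrite NegzE -!exprnN -!natrX /ratr.
have pn0 : (p ^ n.+1)%N%:Z != 0 by rewrite eqz_nat -lt0n expn_gt0 prime_gt0.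
rewrite -[((p ^ n.+1)%N)%:R in X in numq X]/((p ^ n.+1)%N%:Z%:~R).
rewrite -[((p ^ n.+1)%N)%:R in X in denq X]/((p ^ n.+1)%N%:Z%:~R).
rewrite denqVz // -[_^-1 in X in numq X]mul1r -[1 in X in numq X]/(1%:~R).
rewrite coprimeq_num ?coprime1n // mulr1 gtr0_sg ?ltz_nat ?expn_gt0 ?prime_gt0 //.
by rewrite ger0_norm // mul1r.
Qed.

Lemma natp_neq0 : p%:R != 0 :> Qp.
Proof.
apply/eqP => p0; have := padic_abs_p pr_p; rewrite p0 padic_abs0 => /esym/eqP.
by rewrite invr_eq0 gt_eqF.
Qed.

Lemma padic_abs_expp (n : int) : padic_abs (p%:R ^ n : Qp) = p%:R ^ (- n).
Proof.
have absX (m : nat) : padic_abs (p%:R ^+ m : Qp) = p%:R ^- m.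
  elim: m => [|m IH]; first by rewrite expr0 padic_abs1 invr1.
  by rewrite !exprS padic_absM IH padic_abs_p invfM.
case: n => n; first by rewrite absX exprnN.
rewrite NegzE opprK -exprnN; apply: (mulIf (x := p%:R ^- n.+1)).
  by rewrite invr_eq0 expf_neq0 // gt_eqF.
rewrite -{1}absX -padic_absM mulVf ?expf_neq0 ?natp_neq0 // padic_abs1.
by rewrite mulfV // expf_neq0 // gt_eqF.
Qed.

Lemma padic_abs1_neq0 x : padic_abs x = 1 -> x != 0.
Proof.
by move=> x1; apply/eqP => x0; move/eqP: x1; rewrite x0 padic_abs0 eq_sym oner_eq0.
Qed.

(** Serves to read off the unit part of [f x] once it is written as a power of [p] times a unit. *)
Lemma unit_part_expM (n : int) x : padic_abs x = 1 -> unit_part (p%:R ^ n * x) = x.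
Proof.
move=> x1; have x0 := padic_abs1_neq0 x1.
rewrite /unit_part mulf_eq0 expfz_eq0 (negbTE natp_neq0) andbF (negbTE x0) /=.
rewrite padic_absM x1 mulr1 padic_abs_expp ratr_expp mulrA -expfzDr ?natp_neq0 //.
by rewrite addNr expr0z mul1r.
Qed.

Lemma unit_partE x : x != 0 -> x = p%:R ^ padic_val x * unit_part x.
Proof.
move=> x0; rewrite /unit_part (negbTE x0) padic_absE // ratr_expp mulrA.
by rewrite -expfzDr ?natp_neq0 // subrr expr0z mul1r.
Qed.

Lemma padic_abs_unit_part x : padic_abs (unit_part x) = 1.
Proof.
have [->|x0] := eqVneq x 0; first by rewrite /unit_part eqxx padic_abs1.
rewrite /unit_part (negbTE x0) padic_absM (padic_absE x0) ratr_expp padic_abs_expp opprK.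
by rewrite -expfzDr ?gt_eqF // subrr expr0z.
Qed.

Lemma div_unit_part x : x != 0 -> x / unit_part x = p%:R ^ padic_val x.
Proof.
move=> x0; rewrite {1}(unit_partE x0) mulfK //.
exact/padic_abs1_neq0/padic_abs_unit_part.
Qed.

Lemma padic_absV x : padic_abs x^-1 = (padic_abs x)^-1.
Proof.
have [->|x0] := eqVneq x 0; first by rewrite invr0 padic_abs0 invr0.
have ax0 : padic_abs x != 0 by apply: contra x0 => /eqP/padic_abs_eq0->.
by apply: (mulIf ax0); rewrite -padic_absM !mulVf // padic_abs1.
Qed.

Lemma padic_abs_unit_partV x : padic_abs (unit_part x)^-1 = 1.
Proof. by rewrite padic_absV padic_abs_unit_part invr1. Qed.

Lemma padic_abs_unit_partV_le1 x : padic_abs (unit_part x)^-1 <= 1.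
Proof. by rewrite padic_abs_unit_partV. Qed.

(** * Iterates of [tau] and convergence of the series *)

Lemma padic_abs_schneider x : padic_abs (schneider pr_p x) < 1.
Proof. by have [] := padic_floorP (padic_abs_unit_partV_le1 x). Qed.

Lemma padic_abs_iter_schneider x n :
  padic_abs x < 1 -> padic_abs (iter n (schneider pr_p) x) < 1.
Proof. by case: n => //= n _; exact: padic_abs_schneider. Qed.

Lemma padic_val_gt0 x : x != 0 -> (0 < padic_val x) = (padic_abs x < 1).
Proof.
by move=> x0; rewrite padic_absE // -(expr0z p%:R) ltr_eXz2l // oppr_lt0.
Qed.

(** For [x != 0] the valuation is positive, so [p ^ v(x)] is a natural power of [p]; at 0 the
    quotient is 0. *)
Lemma div_unit_part_nat x : padic_abs x < 1 ->
  exists2 w : nat, (p %| w)%N & x / unit_part x = w%:R.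
Proof.
have [->|x0] := eqVneq x 0; first by exists 0%N; rewrite ?dvdn0 // mul0r.
rewrite -padic_val_gt0 // div_unit_part //; case: padic_val => // n n0.
by exists (p ^ n)%N; rewrite ?natrX // dvdn_exp.
Qed.

(** Each of the [n + 1] factors of the product contributes one factor [p]. *)
Lemma conj_term_nat x : padic_abs x < 1 ->
  exists t : nat -> nat, forall n, (p ^ n.+1 %| t n)%N /\ conj_term x n = (t n)%:R.
Proof.
move=> x1; have w m : exists w : nat, (p %| w)%N /\
    iter m (schneider pr_p) x / unit_part (iter m (schneider pr_p) x) = w%:R.
  by have [w] := div_unit_part_nat (padic_abs_iter_schneider m x1); exists w.
have {w}[w wP] := choice w.
exists (fun n => (padic_floor (unit_part (iter n (schneider pr_p) x))^-1 *
  \prod_(0 <= m < n.+1) w m)%N) => n; split.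
  apply: dvdn_mull; elim: n => [|n IH]; first by rewrite big_nat1 (wP 0%N).1.
  by rewrite big_nat_recr //= expnSr dvdn_mul // (wP n.+1).1.
by rewrite natrM natr_prod; congr (_ * _); apply: eq_bigr => m _; rewrite (wP m).2.
Qed.

(** The index [n.+1] allows for splitting off a first term, and [c] for scaling the series by a
    power of [p]. *)
Lemma padic_cvg_lim (s : nat -> Qp) (l : Qp) (c : rat) :
  (forall n, padic_abs (l - s n.+1) <= c * p%:R ^- n) -> limn s = l.
Proof.
move=> sl; apply: cvg_lim; first exact: metric_hausdorff.
(* From [Num.bound (c / e)] on, [c / e < 2 ^ n <= p ^ n]; the successor accounts for the shifted
   index. *)
apply/cvg_ballP => e e0; exists (Num.bound (c / e)).+1 => //= -[//|n] /=.
rewrite ltnS => nb; rewrite ballEmdist /=.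
rewrite -[mdist _ _]/(padic_abs (l - s n.+1)).
rewrite (le_lt_trans (sl n)) // ltr_pdivrMr ?exprn_gt0 // mulrC -ltr_pdivrMr //.
rewrite (lt_le_trans (upper_nthrootP nb)) // lerXn2r ?nnegrE ?ler0n //.
by rewrite ler_nat prime_gt1.
Qed.

Lemma conj_map_approx x : padic_abs x < 1 -> padic_abs (conj_map pr_p x) < 1 /\
  forall n, padic_abs (conj_map pr_p x - series (conj_term x) n) <= p%:R ^- n.
Proof.
move=> /conj_term_nat[t tP].
have tdvd n : ((p ^ n)%N%:Z %| (t n)%:Z)%Z.
  by rewrite dvdzE /= (dvdn_trans _ (tP n).1) // dvdn_exp2l.
pose u n := (\sum_(0 <= k < n) t k)%N.
have uP n : ((u n.+1)%:Z = (u n)%:Z %[mod (p ^ n)%N%:Z])%Z.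
  by rewrite /u big_nat_recr //= PoszD -modzDmr (elimT dvdz_mod0P (tdvd n)) addr0.
have su n : series (conj_term x) n = (u n)%:R.
  by rewrite /series /= natr_sum; apply: eq_bigr => k _; rewrite (tP k).2.
(* The partial sums are compatible modulo the [p ^ n], so they define the sum directly as an element
   of the inverse limit. *)
pose l := (mk_padic_int pr_p uP)%:F.
have ls n : padic_abs (l - series (conj_term x) n) <= p%:R ^- n.
  rewrite su -tofrac_nat -tofracB padic_abs_tofrac_le resB res_nat /=.
  by rewrite -modzDml modz_mod modzDml -modzDmr modzNm modzDmr subrr mod0z.
have -> : conj_map pr_p x = l.
  apply: (@padic_cvg_lim _ _ 1) => n; rewrite mul1r (le_trans (ls _)) //.
  by rewrite lef_pV2 ?posrE ?exprn_gt0 // ler_eXn2l.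
split=> //.
(* Modulo [p] the sum reduces to its first term [t 0], a multiple of [p]. *)
rewrite padic_abs_lt1 -[X in _ <= X^-1]expr1 padic_abs_tofrac_le /= /u big_nat1.
by apply/eqP/dvdz_mod0P; rewrite dvdzE /=; exact: (tP 0%N).1.
Qed.

(** * The recursion for [f] and the conjugacy *)

Lemma conj_mapE x : x != 0 ->
  conj_map pr_p x = p%:R ^ padic_val x *
    ((padic_floor (unit_part x)^-1)%:R + conj_map pr_p (schneider pr_p x)).
Proof.
move=> x0; have [_ fP] := conj_map_approx (padic_abs_schneider x).
(* As [v(x)] may be negative, convergence is transferred from the series at [tau x]; scaling by
   [p ^ v(x)] multiplies the error by this constant. *)
apply: (@padic_cvg_lim _ _ (padic_abs (p%:R ^ padic_val x : Qp))) => n.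
have -> : series (conj_term x) n.+1 = p%:R ^ padic_val x *
    ((padic_floor (unit_part x)^-1)%:R + series (conj_term (schneider pr_p x)) n).
  rewrite /series /= big_nat_recl // mulrDr mulr_sumr; congr (_ + _).
    by rewrite /conj_term big_nat1 /= div_unit_part // mulrC.
  apply: eq_bigr => k _; rewrite /conj_term big_nat_recl //= div_unit_part //.
  rewrite -iterSr /= mulrCA; congr (_ * (_ * _)).
  by apply: eq_bigr => m _; rewrite -iterSr.
rewrite -mulrBr padic_absM opprD addrACA subrr add0r.
by rewrite ler_wpM2l // padic_abs_ge0.
Qed.

Lemma unit_part0 : unit_part (0 : Qp) = 1.
Proof. by rewrite /unit_part eqxx. Qed.

Lemma padic_floor1 : padic_floor (1 : Qp) = 1%N.
Proof. by apply: padic_floor_uniq; rewrite ?prime_gt1 // subrr padic_abs0. Qed.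

Lemma conj_map0 : conj_map pr_p 0 = 0.
Proof.
apply: (@padic_cvg_lim _ _ 0) => n; rewrite /series /= big1 ?subrr ?padic_abs0 ?mul0r //.
by move=> k _; rewrite /conj_term big_nat_recl //= mul0r mul0r mulr0.
Qed.

Lemma conj_map_schneider x :
  conj_map pr_p (schneider pr_p x) = padic_shift pr_p (conj_map pr_p x).
Proof.
have [->|x0] := eqVneq x 0.
  (* Since [eps 0 = 1], both [tau] and [sigma] send 0 to [1 - 1 = 0]. *)
  rewrite /schneider unit_part0 invr1 padic_floor1 subrr conj_map0.
  by rewrite /padic_shift unit_part0 padic_floor1 subrr.
have [fx1 _] := conj_map_approx (padic_abs_schneider x).
rewrite (conj_mapE x0) /padic_shift; set d := padic_floor _.
set r := conj_map pr_p (schneider pr_p x) in fx1 *.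
have [dp d1] := padic_floorP (padic_abs_unit_partV_le1 x).
(* [d] is at distance less than 1 from [1 / eps x], whose absolute value is 1; adding [r] with
   [|r| < 1] then changes nothing. *)
have ad : padic_abs (d%:R : Qp) = 1.
  rewrite -[RHS](padic_abs_unit_partV x); apply: padic_abs_eq.
  by rewrite padic_abs_unit_partV -padic_absN opprB.
have adr : padic_abs (d%:R + r) = 1.
  by rewrite -[RHS]ad; apply: padic_abs_eq; rewrite ad addrAC subrr add0r.
rewrite unit_part_expM // (padic_floor_uniq dp); last by rewrite addrAC subrr add0r.
by rewrite addrAC subrr add0r.
Qed.

End Padic.

Theorem theorem2p6 (p : nat) (pr_p : prime p) :
  conj_map pr_p \o schneider pr_p = padic_shift pr_p \o conj_map pr_p.
Proof. by apply: funext => x; exact: conj_map_schneider. Qed.
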